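(* Let $n\ge1$, $1\le p<\infty$, $0<q\le\infty$, and let $v,w:(0,\infty)\to(0,\infty)$ be weight functions satisfying $v(r)\asymp v(2r)$, $w(r)\asymp w(2r)$ and such that the estimates $$\sup_{r>0}r^{n/p}\,w(r)\,v(1/r)<\infty$$ and $$\sum_{k=-\infty}^m2^kv(2^k)\lesssim 2^mv(2^m),\qquad \sum_{k=m}^\infty v(2^k)\lesssim v(2^m),\qquad m\in\mathbb Z,$$ hold. Then, for $f\in L_1(\mathbb R^n)$, the inequality $$|\widehat f|_{C_{p,q}^w}\lesssim\bigg(\sum_{k\in\mathbb Z}\bigg(\frac1{v(2^k)}\int_{B_{2^{k+1}}(0)\setminus B_{2^k}(0)}|f(x)|\,dx\bigg)^q\bigg)^{1/q}$$ holds (with the usual modification, $\sup_{k\in\mathbb Z}$, for $q=\infty$), with a constant independent of $f$.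
   Context: The Fourier transform of $f\in L_1(\mathbb R^n)$ is $\widehat f(y)=\int_{\mathbb R^n}f(x)e^{-2\pi i(x,y)}\,dx$. $B_r(x)$ is the ball of radius $r$ centered at $x\in\mathbb R^n$, $|B_r|$ is its measure, and $A_rg(x)=\frac1{|B_r|}\int_{B_r(x)}g(y)\,dy$. The weighted Campanato seminorm is $$|g|_{C_{p,q}^w}=\bigg(\int_0^\infty\bigg(w(r)\sup_{x\in\mathbb R^n}\Big(\int_{B_r(x)}|g(y)-A_rg(x)|^p\,dy\Big)^{1/p}\bigg)^q\frac{dr}r\bigg)^{1/q}$$ for $q<\infty$, and $|g|_{C_{p,\infty}^w}=\sup_{r>0}w(r)\sup_{x\in\mathbb R^n}\big(\int_{B_r(x)}|g(y)-A_rg(x)|^p\,dy\big)^{1/p}$. $A\lesssim B$ means $A\le CB$ with a constant $C$ not depending on essential quantities (in the conditions on the weights, $C$ is independent of $r>0$ and $m\in\mathbb Z$), and $A\asymp B$ means $A\lesssim B$ and $B\lesssim A$. The conditions $v(r)\asymp v(2r)$, $w(r)\asymp w(2r)$ are for all $r>0$.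
   Formalization: The conditions v(r)≍v(2r), w(r)≍w(2r) are taken uniformly: v(s)≍v(r), w(s)≍w(r) for all s in [r,2r], r>0, with one constant; with only the two points r and 2r the claim fails, since v between powers of 2 is then unrelated to v(2^k). *)

(* Defs.v *)
From HB Require Import structures.
From mathcomp Require Import all_boot all_order all_algebra.
From mathcomp Require Import all_classical all_reals all_analysis.
From mathcomp Require Import complex.

Set Implicit Arguments.
Unset Strict Implicit.
Unset Printing Implicit Defensive.

Import Order.TTheory GRing.Theory Num.Theory.
Import numFieldNormedType.Exports.

Local Open Scope classical_set_scope.
Local Open Scope ring_scope.

(* R^n is n.-tuple R, with the library's product (Borel) sigma-algebra.  Its
   Lebesgue measure is built by recursion on n: the point mass on R^0, and the
   image of lebesgue_measure \x mu under (a, t) |-> a :: t on R^(n+1).        *)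
Section lebesgue_cons.
Local Open Scope ereal_scope.
Context {R : realType} {n : nat}.
Variable mu : {sigma_finite_measure set (n.-tuple R) -> \bar R}.

Definition tcons (p : measurableTypeR R * n.-tuple R) : n.+1.-tuple R :=
  [tuple of (p.1 : R) :: p.2].

Definition tuncons (t : n.+1.-tuple R) : measurableTypeR R * n.-tuple R :=
  (thead t, [tuple of behead t]).

Lemma tconsK : cancel tcons tuncons.
Proof. by move=> [a t]; congr pair; apply/val_inj. Qed.

Lemma measurable_tcons : measurable_fun setT tcons.
Proof. exact: (measurable_cons (f := fst : _ -> R)). Qed.

Lemma measurable_tuncons : measurable_fun setT tuncons.
Proof.
apply: measurable_fun_pair; last exact: measurable_behead.
exact: (@measurable_tnth _ R).
Qed.

Definition lebesgue_cons : set (n.+1.-tuple R) -> \bar R :=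
  pushforward (lebesgue_measure \x mu) tcons.

HB.instance Definition _ := Measure.copy lebesgue_cons
  (measure_function_pushforward__canonical__measure_function_Measure
     (lebesgue_measure \x mu) measurable_tcons).

Let lebesgue_cons_sigma_finite : sigma_finite setT lebesgue_cons.
Proof.
have /sigma_finiteP[F [TF ndF Foo]] := sigma_finiteT (@lebesgue_measure R).
have /sigma_finiteP[G [TG ndG Goo]] := sigma_finiteT mu.
exists (fun k => tuncons @^-1` (F k `*` G k)) => [|k].
  rewrite -preimage_bigcup (_ : \bigcup_k _ = setT) ?preimage_setT//.
  apply/seteqP; split => // -[x y] _.
  have [i _ Fix] : (\bigcup_i F i) x by rewrite -TF.
  have [j _ Gjy] : (\bigcup_i G i) y by rewrite -TG.
  exists (maxn i j) => //; split.
    by move: x Fix; exact/subsetPset/ndF/leq_maxl.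
  by move: y Gjy; exact/subsetPset/ndG/leq_maxr.
have [mF Fk] := Foo k; have [mG Gk] := Goo k; split.
  rewrite -[X in measurable X]setTI; apply: measurable_tuncons => //.
  exact: measurableX.
rewrite /lebesgue_cons /pushforward -comp_preimage.
rewrite (_ : tuncons \o tcons = id); last by apply/funext => p; exact: tconsK.
by rewrite preimage_id product_measure1E// lte_mul_pinfty// ge0_fin_numE.
Qed.

HB.instance Definition _ := Measure_isSigmaFinite.Build _ _ _
  lebesgue_cons lebesgue_cons_sigma_finite.

End lebesgue_cons.

Fixpoint lebesgue_tuple (R : realType) (n : nat) :
    {sigma_finite_measure set (n.-tuple R) -> \bar R} :=
  if n is m.+1 then lebesgue_cons (lebesgue_tuple R m)
  else dirac ([tuple] : 0.-tuple R).

Lemma lebesgue_tuple_box (R : realType) (n : nat) (A : 'I_n -> set R) :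
  (forall i, measurable (A i)) ->
  lebesgue_tuple R n [set t | forall i, A i (tnth t i)] =
  (\prod_(i < n) lebesgue_measure (A i))%E.
Proof.
elim: n A => [|n IHn] A mA.
  by rewrite big_ord0 /= diracE mem_set// => -[].
have mB : measurable [set t : n.-tuple R | forall i, A (lift ord0 i) (tnth t i)].
  rewrite (_ : mkset _ = \bigcap_(i in [set: 'I_n])
    (fun t => tnth t i) @^-1` A (lift ord0 i)); last first.
    by apply/seteqP; split => t At i; [move=> _|]; exact: At.
  apply: fin_bigcap_measurable => // i _.
  by rewrite -[X in measurable X]setTI; exact: measurable_tnth.
rewrite big_ord_recl -(IHn (fun i => A (lift ord0 i)))//.
rewrite -product_measure1E//=; last exact: mA.
rewrite /lebesgue_cons /pushforward; congr (_ _); apply/seteqP; split.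
- move=> [a t] /= At; split; first exact: (At ord0).
  by move=> i; have := At (lift ord0 i); rewrite tnthS.
- move=> [a t] /= [Aa At] i; case: (unliftP ord0 i) => [j ->|->]//.
  by rewrite tnthS; exact: At.
Qed.

Local Open Scope complex_scope.

Section fourier.
Context {R : realType} {n : nat}.
Implicit Types (x y : n.-tuple R) (r p : R) (f g : n.-tuple R -> R[i]).

Local Notation mu := (lebesgue_tuple R n).

Definition dotp x y : R := \sum_(i < n) tnth x i * tnth y i.

Definition euclid_dist x y : R :=
  Num.sqrt (\sum_(i < n) (tnth x i - tnth y i) ^+ 2).

Definition euclid_ball x r : set (n.-tuple R) := [set y | euclid_dist x y < r].

Definition origin : n.-tuple R := [tuple 0 | i < n].

Definition dyadic_annulus (k : int) : set (n.-tuple R) :=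
  euclid_ball origin (2 ^ (k + 1)) `\` euclid_ball origin (2 ^ k).

Definition cmod (z : R[i]) : R := ComplexField.Normc.normc z.

Definition expi (t : R) : R[i] := cos t +i* sin t.

(* f is a Borel representative of its class in L_1; fourier f and the integrals
   of |f| below do not depend on the choice of the representative.           *)
Definition L1 f : Prop :=
  [/\ measurable_fun setT (fun x => complex.Re (f x)),
      measurable_fun setT (fun x => complex.Im (f x)) &
      (\int[mu]_x (cmod (f x))%:E < +oo)%E].

(* The library integrates real and extended real functions only. *)
Definition cintegral (D : set (n.-tuple R)) g : R[i] :=
  (\int[mu]_(x in D) complex.Re (g x)) +i* (\int[mu]_(x in D) complex.Im (g x)).

Definition fourier f y : R[i] :=
  cintegral setT (fun x => f x * expi (- (2 * pi * dotp x y))).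

Definition average r g x : R[i] :=
  (fine (mu (euclid_ball x r)))^-1%:C * cintegral (euclid_ball x r) g.

Local Open Scope ereal_scope.

Definition oscillation p g x r : \bar R :=
  (\int[mu]_(y in euclid_ball x r) (cmod (g y - average r g x) `^ p)%:E) `^ p^-1.

Definition weighted_oscillation p (w : R -> R) g r : \bar R :=
  (w r)%:E * ereal_sup [set oscillation p g x r | x in setT].

(* In this definition and in dyadic_norm, q = -oo is excluded by 0 < q. *)
Definition campanato p (q : \bar R) (w : R -> R) g : \bar R :=
  match q with
  | q'%:E => (\int[lebesgue_measure]_(r in `]0%R, +oo[)
               (weighted_oscillation p w g r `^ q' * r^-1%:E)) `^ q'^-1
  | +oo => ereal_sup [set weighted_oscillation p w g r | r in `]0%R, +oo[]
  | -oo => 0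
  end.

Definition weighted_dyadic_mass (v : R -> R) f (k : int) : \bar R :=
  (v (2 ^ k))^-1%:E * \int[mu]_(x in dyadic_annulus k) (cmod (f x))%:E.

Definition dyadic_norm (q : \bar R) (v : R -> R) f : \bar R :=
  match q with
  | q'%:E => (\esum_(k in [set: int]) weighted_dyadic_mass v f k `^ q') `^ q'^-1
  | +oo => ereal_sup [set weighted_dyadic_mass v f k | k in [set: int]]
  | -oo => 0
  end.

End fourier.

(* v(r) ~ v(2r) is taken to mean that v is comparable to v(r) on all of [r, 2r],
   uniformly in r > 0, as for monotone v.  Comparing v at the two points r and
   2r only leaves its values between consecutive powers of 2 unrelated to those
   at the powers of 2, and then the Campanato seminorm can be infinite while the
   dyadic norm is finite.  For instance, with n = 1, p = 2 and q = +oo, take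
   v(r) = r^(-1/2) g(r) and w(r) = r^(-1) / g(1/r), where g(2r) = g(r), g(1) = 1
   and g(1/r) = r - 1 for 1 < r < 2; w is unbounded near 1.                   *)
Definition doubling (R : realType) (v : R -> R) : Prop :=
  exists2 C : R, 0 < C &
    forall r s : R, 0 < r -> r <= s <= 2 * r -> v s <= C * v r /\ v r <= C * v s.

(* Main.v *)
(* Write g for the Fourier transform of f.  For y, z in B_r(x), |g y - g z| is at
   most a constant times the integral of |f u| min(1, r |u|), so this also bounds
   the distance of g y to the mean of g over the ball, and the oscillation of g
   over B_r(x) is at most a constant times r^(n/p) times that integral.  For
   r ~ 2^-m, splitting the integral into dyadic annuli and using that
   r^(n/p) w(r) v(1/r) is bounded, the weighted oscillation is at most a constant
   times
     sum_k min(1, 2^(k-m)) (v(2^k) / v(2^m)) a_k,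
   where a_k is the k-th term of the dyadic norm.  The two summability conditions
   on v force min(1, 2^(k-m)) v(2^k) / v(2^m) <= K eta^(2|k-m|) with eta < 1.
   Spending one factor eta^|k-m| on the summation leaves
   sup_k eta^|k-m| a_k <= (sum_k (eta^|k-m| a_k)^q)^(1/q), which works for every
   q > 0 without Hoelder's inequality; summing the q-th powers over m concludes. *)
Require Import Defs.
From mathcomp Require Import all_boot all_order all_algebra.
From mathcomp Require Import all_classical all_reals all_analysis.
From mathcomp Require Import measurable_realfun complex.
From mathcomp Require Import ring lra zify.
Set Implicit Arguments.
Unset Strict Implicit.
Unset Printing Implicit Defensive.
Import Order.TTheory GRing.Theory Num.Theory.
Import numFieldNormedType.Exports.
Local Open Scope classical_set_scope.
Local Open Scope ring_scope.

(** * Integrals of nonnegative functions that may fail to be measurable *)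

Section lower_integral.
Local Open Scope ereal_scope.
Context d (T : measurableType d) (R : realType).
Variable mu : {measure set T -> \bar R}.

Import HBNNSimple.

(* Nothing makes w, hence the weighted oscillation, measurable in r: the lemmas of
   this section only use that the library's integral of a nonnegative function,
   measurable or not, is the supremum over the simple functions below it.     *)
Lemma ge0_integral_le_nnsfun (D : set T) (f : T -> \bar R) (M : \bar R) :
  (forall x, D x -> 0 <= f x) ->
  (forall h : {nnsfun T >-> R}, (forall x, (h x)%:E <= (f \_ D) x) ->
    \int[mu]_x (h x)%:E <= M) ->
  \int[mu]_(x in D) f x <= M.
Proof.
move=> f0 fM; rewrite integral_mkcond ge0_integralTE; last first.
  by move=> x; exact: erestrict_ge0.
apply: ge_ereal_sup => _ [h /= hf <-].
by rewrite -integralT_nnsfun; exact: fM.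
Qed.

Lemma ge0_le_integral_nonmeasurable (D : set T) (f g : T -> \bar R) :
  (forall x, D x -> 0 <= f x) -> (forall x, D x -> f x <= g x) ->
  \int[mu]_(x in D) f x <= \int[mu]_(x in D) g x.
Proof.
move=> f0 fg; have g0 x : D x -> 0 <= g x.
  by move=> Dx; exact: le_trans (f0 _ Dx) (fg _ Dx).
apply: ge0_integral_le_nnsfun => // h hf.
rewrite integralT_nnsfun integral_mkcond ge0_integralTE; last first.
  by move=> x; exact: erestrict_ge0.
apply: ereal_sup_ubound; exists h => // x /=.
by rewrite (le_trans (hf x))//; exact: lee_restrict.
Qed.

End lower_integral.

(** * Series over the integers and countable covers *)

Definition int_of_nat_enum (i : nat) : int :=
  if odd i then Negz i./2 else Posz i./2.

Lemma int_of_nat_enum_bij : set_bij [set: nat] [set: int] int_of_nat_enum.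
Proof.
split => //.
- move=> i j _ _; rewrite /int_of_nat_enum.
  move=> eq_ij; rewrite -(odd_double_half i) -(odd_double_half j).
  by move: eq_ij; case: (odd i); case: (odd j) => // -[->].
- move=> [k|k] _ /=.
  + exists k.*2 => //; rewrite /int_of_nat_enum odd_double.
    by rewrite half_double.
  + exists k.*2.+1 => //; rewrite /int_of_nat_enum /= odd_double /=.
    by rewrite uphalf_double.
Qed.

Lemma esum_int_nneseries (R : realType) (a : int -> \bar R) :
  (forall k, (0 <= a k)%E) ->
  (\esum_(k in [set: int]) a k = \sum_(i <oo) a (int_of_nat_enum i))%E.
Proof.
by move=> a0; rewrite nneseries_esumT// (reindex_esum _ _ _ _ int_of_nat_enum_bij).
Qed.

Section integral_cover.
Local Open Scope ereal_scope.
Context d (T : measurableType d) (R : realType).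
Variable mu : {measure set T -> \bar R}.

Import HBNNSimple.

(** Subadditivity is proved on each simple [h] below [f]. The restrictions of [h] to the sets [F k]
    are measurable, so their series can be integrated term by term, and on [F k] one returns from
    [h] to [f] by monotonicity. It serves both for the annuli in space and for the dyadic intervals
    of radii. *)
Lemma ge0_integral_int_cover (F : int -> set T) (f : T -> \bar R) :
  (forall k, measurable (F k)) ->
  (forall x, (\bigcup_k F k) x -> 0 <= f x) ->
  \int[mu]_(x in \bigcup_k F k) f x <=
  \esum_(k in [set: int]) \int[mu]_(x in F k) f x.
Proof.
move=> mF f0; set D := \bigcup_k F k.
have f0F k x : F k x -> 0 <= f x by move=> Fx; apply: f0; exists k.
apply: ge0_integral_le_nnsfun => // h hf.
pose H x : \bar R := (h x)%:E.
have H0 x : 0 <= H x by rewrite lee_fin.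
have mH : measurable_fun [set: T] H by exact/measurable_EFinP.
have p0 i x : 0 <= (H \_ (F (int_of_nat_enum i))) x.
  exact: erestrict_ge0.
have mp i : measurable_fun [set: T] (H \_ (F (int_of_nat_enum i))).
  by apply/(measurable_restrictT _ _).1 => //; exact: measurable_funTS.
have hD x : H x <= \sum_(i <oo) (H \_ (F (int_of_nat_enum i))) x.
  have [Dx|nDx] := pselect (D x); last first.
    rewrite (le_trans (hf x))// patchE memNset//.
    by rewrite nneseries_ge0.
  have [k _ Fkx] := Dx.
  have [_ _ /(_ k I)[i _ ik]] := int_of_nat_enum_bij.
  (* The partial sum that stops just after the index of one set containing [x] already dominates
     [h x]. *)
  apply: le_trans (@nneseries_lim_ge _ _ xpredT 0%N i.+1 _); last by move=> *; exact: p0.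
  rewrite big_nat_recr//= ik [X in _ + X]patchE mem_set//=.
  by rewrite leeDr// sume_ge0.
apply: (@le_trans _ _ (\int[mu]_x \sum_(i <oo) (H \_ (F (int_of_nat_enum i))) x)).
  by apply: ge0_le_integral_nonmeasurable => x _; [exact: H0|exact: hD].
rewrite integral_nneseries//.
rewrite esum_int_nneseries; last by move=> k; apply: integral_ge0 => x; exact: f0F.
apply: lee_nneseries => [i _ _|i _].
  exact: integral_ge0.
rewrite -integral_mkcond; apply: ge0_le_integral_nonmeasurable => x Fx //.
by rewrite (le_trans (hf x))// patchE mem_set//; exists (int_of_nat_enum i).
Qed.

End integral_cover.

(** * Lipschitz and uniform bounds for sine and cosine *)

Section lipschitz.
Context {R : realType}.
Implicit Types a b : R.

Lemma lipschitz_of_derive_le1 (f df : R -> R) a b :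
  (forall x : R, is_derive x (1 : R) f (df x)) -> (forall x, `|df x| <= 1) ->
  `|f a - f b| <= `|a - b|.
Proof.
move=> fdf df1; wlog ab : a b / b <= a.
  move=> H; have [|/ltW ab] := leP b a; first exact: H.
  by rewrite distrC (distrC a); exact: H.
have cf : {within `[b, a], continuous f}.
  apply: continuous_subspaceT => x; apply: differentiable_continuous.
  by apply/derivable1_diffP; have [] := fdf x.
have [c _ ->] := @MVT_segment _ f df _ _ ab (fun x _ => fdf x) cf.
by rewrite normrM ler_piMl.
Qed.

Lemma cos_lipschitz a b : `|cos a - cos b| <= `|a - b|.
Proof.
apply: (@lipschitz_of_derive_le1 _ (fun x => - sin x)) => x.
by rewrite normrN ler_norml sin_geN1 sin_le1.
Qed.

Lemma sin_lipschitz a b : `|sin a - sin b| <= `|a - b|.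
Proof.
apply: (@lipschitz_of_derive_le1 _ cos) => x.
by rewrite ler_norml cos_geN1 cos_le1.
Qed.

Lemma norm_cos_sub_le2 a b : `|cos a - cos b| <= 2.
Proof.
have := cos_le1 a; have := cos_le1 b; have := cos_geN1 a; have := cos_geN1 b.
by rewrite ler_norml; lra.
Qed.

Lemma norm_sin_sub_le2 a b : `|sin a - sin b| <= 2.
Proof.
have := sin_le1 a; have := sin_le1 b; have := sin_geN1 a; have := sin_geN1 b.
by rewrite ler_norml; lra.
Qed.

End lipschitz.

(** * Geometric decay of the weight across dyadic scales *)

Section geometric_decay.
Context {R : realType}.

(* The tail sums [T i] satisfy [T (i + 1) = T i - u i <= (1 - 1 / C) * T i]. *)
Lemma geometric_decay_of_tail_le (u : nat -> R) (C : R) :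
  1 <= C -> (forall i, 0 <= u i) ->
  (forall i N, \sum_(k < N) u (i + k)%N <= C * u i) ->
  forall j, u j <= C * (1 - C^-1) ^+ j * u 0%N.
Proof.
move=> C1 u0 uC j; have C0 : 0 < C by rewrite (lt_le_trans ltr01).
have th0 : 0 <= 1 - C^-1 by rewrite subr_ge0 invf_le1.
(* The tails are cut off at index [j], so that they are finite sums and [S j] is the single term
   [u j]. *)
pose S i := \sum_(k < j.+1 - i) u (i + k)%N.
have SS i : (i <= j)%N -> S i = u i + S i.+1.
  move=> ij; rewrite /S subSS subSn// big_ord_recl addn0; congr (_ + _).
  by apply: eq_bigr => k _; rewrite lift0 addnS.
have Sle i : (i <= j)%N -> S i <= (1 - C^-1) ^+ i * S 0%N.
  elim: i => [|i IH] ij; first by rewrite expr0 mul1r.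
  have {}IH := IH (ltnW ij).
  have : S i / C <= u i by rewrite ler_pdivrMr// mulrC; exact: uC.
  have := SS _ (ltnW ij) => E1 E2.
  have -> : S i.+1 = S i - u i by rewrite E1; ring.
  rewrite exprS -mulrA; apply: (@le_trans _ _ ((1 - C^-1) * S i)).
    by rewrite mulrBl mul1r lerD2l lerN2 mulrC.
  exact: ler_wpM2l.
have -> : u j = S j by rewrite /S subSnn big_ord_recl big_ord0 addr0 addn0.
rewrite (le_trans (Sle j _))// -mulrA mulrCA ler_wpM2l ?exprn_ge0//.
exact: (uC 0%N).
Qed.

(** Turns the bounds on infinite sums over a half-line of integers into the bounds on finite tail
    sums that the decay argument takes as input. *)
Lemma sum_inj_le_esum (T : choiceType) (S : set T) (a : T -> \bar R)
    (e : nat -> T) (N : nat) : injective e -> (forall k, S (e k)) ->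
  (\sum_(k < N) a (e k) <= \esum_(i in S) a i)%E.
Proof.
move=> ie Se; apply: esum_ge; exists (e @` `I_N).
  split; first exact/finite_image/finite_II.
  by move=> _ [k _ <-].
rewrite (reindex_fsbig e `I_N)//; last by apply/inj_bij => x y _ _; exact: ie.
by rewrite -fsbig_ord.
Qed.

Lemma dyadicD (m n : int) : (2 : R) ^ (m + n) = 2 ^ m * 2 ^ n.
Proof. by rewrite expfzDr. Qed.

Lemma dyadic_gt0 (k : int) : 0 < (2 : R) ^ k.
Proof. exact: exprz_gt0. Qed.

(** For [m <= k] the decay lemma is applied to the values of [v] at 2^(m+i), whose tails [v_high]
    controls. For [k <= m] it is applied to 2^(m-i) v(2^(m-i)), whose tails [v_low] controls, and
    the result is divided by 2^m. *)
Lemma dyadic_kernel_decay (v : R -> R) (v_gt0 : forall r, 0 < r -> 0 < v r)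
    (v_low : exists2 C : R, 0 < C & forall m : int,
       (\esum_(k in [set k : int | (k <= m)%R]) (2 ^ k * v (2 ^ k))%:E
        <= (C * (2 ^ m * v (2 ^ m)))%:E)%E)
    (v_high : exists2 C : R, 0 < C & forall m : int,
       (\esum_(k in [set k : int | (m <= k)%R]) (v (2 ^ k))%:E
        <= (C * v (2 ^ m))%:E)%E) :
  exists2 K : R, 0 < K & exists2 eta : R, 0 < eta < 1 &
    forall k m : int, Num.min 1 (2 ^ (k - m)) * v (2 ^ k) <=
      K * (eta ^+ `|k - m| * eta ^+ `|k - m|) * v (2 ^ m).
Proof.
have [C1 _ low] := v_low; have [C2 _ high] := v_high.
(* One constant for both conditions; [C >= 2] keeps the ratio [1 - C^-1] at least 1/2, so that its
   square root is positive. *)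
pose C := Num.max 2 (Num.max C1 C2).
have C2' : 2 <= C by rewrite /C le_max lexx.
have C1C : C1 <= C by rewrite /C !le_max lexx !orbT.
have C2C : C2 <= C by rewrite /C !le_max lexx !orbT.
have C0 : 0 < C by lra.
have v0 k : 0 < v (2 ^ k) by apply/v_gt0/dyadic_gt0.
have Ci : 0 < C^-1 <= 2^-1 by rewrite invr_gt0 C0 lef_pV2 ?posrE.
(* The square root splits the decay into two equal factors: one will be spent on the sum over [k],
   the other stays attached to the dyadic masses. *)
pose eta := Num.sqrt (1 - C^-1).
have etaE : eta * eta = 1 - C^-1 by rewrite -expr2 sqr_sqrtr//; lra.
exists C => //; exists eta.
  have : 0 < eta by rewrite sqrtr_gt0; lra.
  by nra.
move=> k m; rewrite -exprMn etaE.
have hi j : v (2 ^ (m + Posz j)) <= C * (1 - C^-1) ^+ j * v (2 ^ m).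
  have := @geometric_decay_of_tail_le (fun i => v (2 ^ (m + Posz i))) C.
  rewrite addr0; apply; [lra|by move=> i; exact: ltW|move=> i N].
  rewrite -lee_fin (le_trans _ (le_trans (high (m + Posz i)) _))//; last first.
    by rewrite lee_fin ler_wpM2r// ltW.
  rewrite -sumEFin.
  rewrite (eq_bigr (fun l : 'I_N => (v (2 ^ (m + Posz i + Posz l)))%:E)).
    apply: (@sum_inj_le_esum _ _ (fun l => (v (2 ^ l))%:E) (fun l => m + Posz i + Posz l)).
      by move=> x y /addrI[].
    by move=> l /=; lia.
  by move=> l _; rewrite PoszD addrA.
have lo j : 2 ^ (m - Posz j) * v (2 ^ (m - Posz j)) <=
    C * (1 - C^-1) ^+ j * (2 ^ m * v (2 ^ m)).
  have := @geometric_decay_of_tail_le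
    (fun i => 2 ^ (m - Posz i) * v (2 ^ (m - Posz i))) C.
  have w0 l : 0 <= 2 ^ l * v (2 ^ l) by rewrite mulr_ge0// ltW// dyadic_gt0.
  rewrite subr0; apply; [lra|by move=> i; exact: w0|move=> i N].
  rewrite -lee_fin (le_trans _ (le_trans (low (m - Posz i)) _))//; last first.
    by rewrite lee_fin ler_wpM2r.
  rewrite -sumEFin.
  rewrite (eq_bigr (fun l : 'I_N => (2 ^ (m - Posz i - Posz l) *
      v (2 ^ (m - Posz i - Posz l)))%:E)).
    apply: (@sum_inj_le_esum _ _ (fun l => (2 ^ l * v (2 ^ l))%:E)
      (fun l => m - Posz i - Posz l)).
      by move=> x y /addrI/oppr_inj[].
    by move=> l /=; lia.
  by move=> l _; rewrite PoszD opprD addrA.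
have [mk|/ltW km] := leP m k.
  have -> : k = m + Posz `|k - m| by lia.
  rewrite (_ : m + _ - m = Posz `|k - m|); last by lia.
  rewrite absz_nat (le_trans _ (hi _))// ler_piMl ?ge_min ?lexx//.
  exact: ltW.
have E : k = m - Posz `|k - m| by lia.
move: E; set j := `|k - m|%N => ->; have := lo j.
rewrite (_ : m - _ - m = - Posz j); last by lia.
move=> H; have {}H : 2 ^ (- Posz j) * v (2 ^ (m - Posz j)) <=
    C * (1 - C^-1) ^+ j * v (2 ^ m).
  rewrite -(ler_pM2l (dyadic_gt0 m)) mulrA -dyadicD (le_trans H)//.
  by rewrite mulrCA lexx.
apply: le_trans H.
by rewrite ler_wpM2r ?ge_min ?lexx ?orbT// ltW.
Qed.

Lemma esum_int_geometric (eta : R) (m : int) : 0 < eta < 1 ->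
  (\esum_(k in [set: int]) (eta ^+ `|k - m|)%:E <= (2 / (1 - eta))%:E)%E.
Proof.
move=> /andP[e0 e1].
have bij : set_bij [set: int] [set: int] (fun k : int => k + m).
  split => //; first by move=> x y _ _ /addIr.
  by move=> k _; exists (k - m) => //; rewrite subrK.
rewrite (reindex_esum _ _ _ _ bij).
under eq_esum do rewrite addrK.
rewrite esum_int_nneseries; last by move=> k; rewrite lee_fin exprn_ge0 ?ltW.
apply: lime_le.
  by apply: is_cvg_nneseries => i _ _; rewrite lee_fin exprn_ge0 ?ltW.
apply: nearW => N.
rewrite sumEFin lee_fin.
(* The enumeration runs through 0, -1, 1, -2, ..., so entries 2i and 2i+1 have absolute values i and
   i+1, and such a pair contributes at most 2 eta^i. *)
have half n : \sum_(0 <= i < n.*2) eta ^+ `|int_of_nat_enum i| <=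
    2 * \sum_(0 <= i < n) eta ^+ i.
  elim: n => [|n IH]; first by rewrite !big_nil mulr0.
  rewrite doubleS !big_nat_recr//= mulrDr -addrA lerD//.
  rewrite /int_of_nat_enum /= odd_double /= half_double uphalf_double.
  rewrite mulr2n mulrDl mul1r lerD//.
  by rewrite exprS ler_piMl ?exprn_ge0 ?ltW.
(* The partial sum is lengthened to an even number of terms, so that it consists of whole pairs. *)
apply: (@le_trans _ _ (\sum_(0 <= i < N.*2) eta ^+ `|int_of_nat_enum i|)).
  rewrite (@big_cat_nat _ _ _ N 0 N.*2)//=; last by rewrite -addnn leq_addr.
  by rewrite lerDl sumr_ge0// => i _; rewrite exprn_ge0 ?ltW.
rewrite (le_trans (half N))// big_mkord.
have ne0 : 0 < 1 - eta by rewrite subr_gt0.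
rewrite ler_pdivlMr//.
have -> : 2 * (\sum_(i < N) eta ^+ i) * (1 - eta) = 2 * (1 - eta ^+ N).
  by rewrite -mulrA -[1 - eta ^+ N]opprB subrX1; ring.
by have := exprn_ge0 N (ltW e0); lra.
Qed.

End geometric_decay.

(** * Dyadic scales, balls, cubes and annuli *)

Lemma dyadic_scale (R : realType) (r : R) : 0 < r ->
  exists k : int, 2 ^ k <= r < 2 ^ (k + 1).
Proof.
move=> r0; have ln2 : 0 < ln (2 : R) by rewrite ln_gt0// ltr1n.
have expE (k : int) : 2 ^ k = expR (k%:~R * ln 2) :> R.
  by rewrite -powR_intmul// /powR gt_eqF.
exists (Num.floor (ln r / ln 2)); rewrite !expE -{2 3}(lnK r0) ler_expR ltr_expR.
by rewrite -ler_pdivlMr// -ltr_pdivrMr// floor_itv.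
Qed.

Section euclid_geometry.
Context {R : realType} {n : nat}.
Implicit Types (x y z u : n.-tuple R) (r : R).

Lemma euclid_dist_ge0 x y : 0 <= euclid_dist x y.
Proof. exact: sqrtr_ge0. Qed.

Lemma norm_tnth_sub_le_euclid_dist x y i :
  `|tnth x i - tnth y i| <= euclid_dist x y.
Proof.
rewrite -sqrtr_sqr ler_wsqrtr// (bigD1 i)//= lerDl.
by rewrite sumr_ge0// => j _; exact: sqr_ge0.
Qed.

Lemma norm_tnth_le_euclid_dist_origin u i : `|tnth u i| <= euclid_dist origin u.
Proof.
have := norm_tnth_sub_le_euclid_dist origin u i.
by rewrite tnth_mktuple sub0r normrN.
Qed.

Lemma euclid_dist_eq0 x y : euclid_dist x y = 0 -> x = y.
Proof.
move=> xy; apply: eq_from_tnth => i; apply/eqP; rewrite -subr_eq0 -normr_le0.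
by rewrite -xy norm_tnth_sub_le_euclid_dist.
Qed.

(** Estimated coordinate by coordinate: each coordinate of y - z is at most 2r in absolute value and
    each coordinate of u at most |u|, which costs the factor [n]. *)
Lemma norm_dotp_sub_le x r u y z : euclid_ball x r y -> euclid_ball x r z ->
  `|dotp u y - dotp u z| <= n%:R * (euclid_dist origin u * (2 * r)).
Proof.
rewrite /euclid_ball /= => xy xz; rewrite /dotp -sumrB.
apply: (le_trans (ler_norm_sum _ _ _)).
apply: (@le_trans _ _ (\sum_(i < n) (euclid_dist origin u * (2 * r)))).
  apply: ler_sum => i _; rewrite -mulrBr normrM ler_pM//.
    exact: norm_tnth_le_euclid_dist_origin.
  rewrite (_ : tnth y i - tnth z i =
    (tnth x i - tnth z i) - (tnth x i - tnth y i)); last by ring.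
  apply: (le_trans (ler_normB _ _)).
  have := norm_tnth_sub_le_euclid_dist x y i.
  have := norm_tnth_sub_le_euclid_dist x z i.
  by lra.
by rewrite sumr_const card_ord [leRHS]mulr_natl lexx.
Qed.

Lemma measurable_euclid_dist x : measurable_fun [set: n.-tuple R] (euclid_dist x).
Proof.
apply: (measurableT_comp (f := @Num.sqrt R)).
  by apply: continuous_measurable_fun; exact: sqrt_continuous.
apply: measurable_sum => i; apply: measurable_funX.
by apply: measurable_funB => //; exact: measurable_tnth.
Qed.

Lemma measurable_euclid_ball x r : measurable (euclid_ball x r).
Proof.
rewrite (_ : euclid_ball x r = [set: n.-tuple R] `&` euclid_dist x @^-1` `]-oo, r[).
  exact: measurable_euclid_dist.
by rewrite setTI; apply/seteqP; split => y /=; rewrite in_itv.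
Qed.

Lemma lebesgue_tuple_cube x r : 0 <= r ->
  lebesgue_tuple R n [set y | forall i, tnth y i \in `]tnth x i - r, tnth x i + r[] =
  ((2 * r) ^+ n)%:E.
Proof.
move=> r0; rewrite (@lebesgue_tuple_box R n
  (fun i => `]tnth x i - r, tnth x i + r[%classic))//.
rewrite (eq_bigr (fun=> (2 * r)%:E)); last first.
  move=> i _; rewrite lebesgue_measure_itv /= lte_fin -EFinD.
  case: ifPn => [_|]; first by congr EFin; ring.
  rewrite -leNgt => ?; congr EFin; lra.
by rewrite prodEFin prodr_const card_ord.
Qed.

Lemma measurable_cube x r :
  measurable [set y : n.-tuple R | forall i, tnth y i \in `]tnth x i - r, tnth x i + r[].
Proof.
rewrite (_ : mkset _ = \bigcap_(i in [set: 'I_n])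
  ([set: n.-tuple R] `&` (fun t => tnth t i) @^-1` `]tnth x i - r, tnth x i + r[)).
  by apply: fin_bigcap_measurable => // i _; exact: measurable_tnth.
apply/seteqP; split => t /= tx i; first by move=> _; split => //; exact: tx.
by have [] := tx i I.
Qed.

Lemma lebesgue_tuple_ball_le x r : 0 <= r ->
  (lebesgue_tuple R n (euclid_ball x r) <= ((2 * r) ^+ n)%:E)%E.
Proof.
move=> r0; rewrite -(lebesgue_tuple_cube x r0); apply: le_measure; rewrite ?inE.
- exact: measurable_euclid_ball.
- exact: measurable_cube.
move=> y; rewrite /euclid_ball/= => yr i; rewrite in_itv/=.
have := norm_tnth_sub_le_euclid_dist x y i.
by rewrite ler_norml => /andP[? ?]; apply/andP; split; lra.
Qed.

(** The mean over a ball divides by this measure. The ball contains a cube of half-side r/(2n),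
    because n (r/(2n))^2 = r^2/(4n) < r^2. *)
Lemma lebesgue_tuple_ball_gt0 x r : (0 < n)%N -> 0 < r ->
  (0 < lebesgue_tuple R n (euclid_ball x r))%E.
Proof.
move=> n0 r0; have n0' : 0 < n%:R :> R by rewrite ltr0n.
have s0 : 0 < r / (2 * n%:R) by rewrite divr_gt0// mulr_gt0.
have : (0 < ((2 * (r / (2 * n%:R))) ^+ n)%:E)%E by rewrite lte_fin exprn_gt0// mulr_gt0.
rewrite -(lebesgue_tuple_cube x (ltW s0)) => /lt_le_trans; apply.
apply: le_measure; rewrite ?inE.
- exact: measurable_cube.
- exact: measurable_euclid_ball.
move=> y /= yx; rewrite /euclid_ball /=.
rewrite -[ltRHS]ger0_norm ?(ltW r0)// -sqrtr_sqr ltr_sqrt ?exprn_gt0//.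
apply: (@le_lt_trans _ _ (\sum_(i < n) (r / (2 * n%:R)) ^+ 2)).
  apply: ler_sum => i _; have := yx i; rewrite in_itv/= => /andP[? ?].
  rewrite -[leLHS]real_normK ?num_real// lerXn2r ?nnegrE ?(ltW s0)//.
  by rewrite ler_norml; apply/andP; split; lra.
rewrite sumr_const card_ord -[ltLHS]mulr_natl.
have n1 : 1 <= n%:R :> R by rewrite ler1n.
move: (n%:R : R) n0' n1 {s0} => N N0 N1.
rewrite (_ : N * _ = r ^+ 2 / (4 * N)); last by field; rewrite gt_eqF.
rewrite ltr_pdivrMr ?mulr_gt0// ltr_pMr ?exprn_gt0//; lra.
Qed.

Lemma measurable_dyadic_annulus (k : int) : measurable (@dyadic_annulus R n k).
Proof. by apply: measurableD; exact: measurable_euclid_ball. Qed.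

Lemma bigcup_dyadic_annulus :
  \bigcup_k (@dyadic_annulus R n k) = [set~ origin].
Proof.
apply/seteqP; split => [x [k _ [_ xk]] /= x0|x /= x0].
  apply: xk; rewrite x0 /euclid_ball /= /euclid_dist big1 ?sqrtr0 ?dyadic_gt0//.
  by move=> i _; rewrite subrr expr0n.
have d0 : 0 < euclid_dist origin x.
  rewrite lt_neqAle euclid_dist_ge0 andbT eq_sym.
  by apply/eqP => /euclid_dist_eq0 /esym.
have [k /andP[k1 k2]] := dyadic_scale d0.
by exists k => //; split => //=; rewrite /euclid_ball /= ltNge k1.
Qed.

End euclid_geometry.

(** * Deviation from the mean, and real trigonometric integrals *)

Lemma norm_sub_mean_le d (T : measurableType d) (R : realType)
    (mu : {measure set T -> \bar R}) (B : set T) (G : T -> R) (D : R) (y : T) :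
  measurable B -> (0 < mu B)%E -> (mu B < +oo)%E -> measurable_fun B G ->
  (forall z, B z -> `|G y - G z| <= D) ->
  `|G y - (fine (mu B))^-1 * \int[mu]_(z in B) G z| <= D.
Proof.
move=> mB B0 Boo mG GD.
have fB0 : 0 < fine (mu B) by rewrite fine_gt0// B0.
have intc c : mu.-integrable B (EFin \o cst c).
  by apply: measurable_bounded_integrable => //; exists `|c|; split => //= t ct z _ /=; exact: ltW.
(* On [B] the function [G] stays within [D] of the number [G y], hence is bounded on a set of finite
   measure. *)
have intG : mu.-integrable B (EFin \o G).
  apply: measurable_bounded_integrable => //.
  exists (`|G y| + D); split; first exact: num_real.
  move=> M ltM z Bz /=; apply: ltW; apply: le_lt_trans ltM.
  rewrite (_ : G z = G y - (G y - G z)); last by ring.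
  by rewrite (le_trans (ler_normB _ _))// lerD2l GD.
have intB : mu.-integrable B (EFin \o (fun z => G y - G z)).
  by rewrite (_ : _ \o _ = (EFin \o cst (G y)) \- (EFin \o G))%E//; exact: integrableB.
(* The deviation from the mean is the mean of the deviations [G y - G z]. *)
have -> : G y - (fine (mu B))^-1 * \int[mu]_(z in B) G z =
    (fine (mu B))^-1 * \int[mu]_(z in B) (G y - G z).
  rewrite RintegralB//; last exact: intc.
  by rewrite Rintegral_cst//; field; rewrite gt_eqF.
rewrite normrM gtr0_norm ?invr_gt0// ler_pdivrMl// mulrC.
rewrite -Rintegral_cst//; apply: (le_trans (le_normr_Rintegral mB intB)).
apply: le_Rintegral => //; first exact: integrable_norm.
exact: intc.
Qed.

Section trigonometric_integral.
Context {R : realType} {n : nat}.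
Local Notation mu := (lebesgue_tuple R n).
Variables (phi psi F : n.-tuple R -> R).
Hypothesis mphi : measurable_fun [set: n.-tuple R] phi.
Hypothesis mpsi : measurable_fun [set: n.-tuple R] psi.
Hypothesis mF : measurable_fun [set: n.-tuple R] F.
Hypothesis phiF : forall u, `|phi u| <= F u.
Hypothesis psiF : forall u, `|psi u| <= F u.
Hypothesis intF : (\int[mu]_u (F u)%:E < +oo)%E.

Definition phase (u y : n.-tuple R) : R := - (2 * pi * dotp u y).

(** Common shape of both parts of the Fourier integrand: [(phi, psi)] is (Re f, -Im f) for the real
    part and (Im f, Re f) for the imaginary part. *)
Definition trig_integrand (y u : n.-tuple R) : R :=
  phi u * cos (phase u y) + psi u * sin (phase u y).

Definition trig_integral (y : n.-tuple R) : R := \int[mu]_u trig_integrand y u.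

Let F0 u : 0 <= F u. Proof. exact: le_trans (normr_ge0 _) (phiF u). Qed.

Let measurable_trig_integrand_pair : measurable_fun [set: n.-tuple R * n.-tuple R]
  (fun uy => trig_integrand uy.2 uy.1).
Proof.
have mphase : measurable_fun [set: n.-tuple R * n.-tuple R]
    (fun uy => phase uy.1 uy.2).
  apply: measurable_funN; apply: measurable_funM => //.
  apply: measurable_sum => i; apply: measurable_funM.
    exact: measurableT_comp (@measurable_tnth _ _ _ _) measurable_fst.
  exact: measurableT_comp (@measurable_tnth _ _ _ _) measurable_snd.
apply: measurable_funD; apply: measurable_funM.
- exact: measurableT_comp mphi measurable_fst.
- apply: measurableT_comp mphase.
  by apply: continuous_measurable_fun; exact: continuous_cos.
- exact: measurableT_comp mpsi measurable_fst.
- apply: measurableT_comp mphase.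
  by apply: continuous_measurable_fun; exact: continuous_sin.
Qed.

Lemma measurable_trig_integrand y :
  measurable_fun [set: n.-tuple R] (trig_integrand y).
Proof.
exact: (measurableT_comp measurable_trig_integrand_pair (measurable_pair2 y)).
Qed.

(** The integrand is jointly measurable, so Tonelli's theorem applies to its positive and negative
    parts. This makes the transform measurable, as integration over a ball requires. *)
Lemma measurable_trig_integral : measurable_fun [set: n.-tuple R] trig_integral.
Proof.
apply: (measurableT_comp (f := @fine R)) => //.
pose E (uy : n.-tuple R * n.-tuple R) := (trig_integrand uy.2 uy.1)%:E.
have mE : measurable_fun setT E by exact/measurable_EFinP.
rewrite (_ : (fun y => _) = fubini_G mu (E^\+)%E \- fubini_G mu (E^\-)%E)%E.
  apply: emeasurable_funB; apply: measurable_fun_fubini_tonelli_G => //.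
  exact: measurable_funepos.
  exact: measurable_funeneg.
apply/funext => y; rewrite integralE /fubini_G.
by congr (_ - _)%E; apply: eq_integral => u _; rewrite !(funeposE, funenegE).
Qed.

Lemma integrable_trig_integrand y : mu.-integrable setT (EFin \o trig_integrand y).
Proof.
apply: (@le_integrable _ _ _ _ _ _ _ (fun u => (2 * F u)%:E)) => //.
- by apply/measurable_EFinP; exact: measurable_trig_integrand.
- move=> u _ /=; rewrite lee_fin [leRHS]ger0_norm ?mulr_ge0//.
  apply: (le_trans (ler_normD _ _)); rewrite !normrM mulr2n mulrDl mul1r.
  apply: lerD; [apply: le_trans (phiF u)|apply: le_trans (psiF u)].
    by rewrite ler_piMr// ler_norml cos_geN1 cos_le1.
  by rewrite ler_piMr// ler_norml sin_geN1 sin_le1.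
- apply/integrableP; split; first by apply/measurable_EFinP; exact: measurable_funM.
  under eq_integral do rewrite /= ger0_norm ?mulr_ge0// EFinM.
  have mFE : measurable_fun [set: n.-tuple R] (EFin \o F) by exact/measurable_EFinP.
  rewrite (ge0_integralZl _ measurableT mFE)//; last by move=> u _; rewrite lee_fin.
  by rewrite lte_mul_pinfty.
Qed.

(** The cosine and the sine difference are each at most 2 and at most the phase difference, so their
    sum is at most the minimum in the hypothesis. The majorant [k] is kept abstract so that a single
    function can serve all [y], [z] in a ball. *)
Lemma trig_integral_sub_le y z (k : n.-tuple R -> R) :
  measurable_fun setT k ->
  (forall u, Num.min 4 (2 * `|phase u y - phase u z|) <= k u <= 4) ->
  (`|trig_integral y - trig_integral z|%:E <= \int[mu]_u (F u * k u)%:E)%E.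
Proof.
move=> mk hk.
have k0 u : 0 <= k u.
  by have /andP[+ _] := hk u; apply: le_trans; rewrite le_min mulr_ge0// andbT.
rewrite /trig_integral -RintegralB//; try exact: integrable_trig_integrand.
have intB : mu.-integrable setT
    (EFin \o (fun u => trig_integrand y u - trig_integrand z u)).
  rewrite (_ : _ \o _ = (EFin \o trig_integrand y) \- (EFin \o trig_integrand z))%E//.
  by apply: integrableB => //; exact: integrable_trig_integrand.
rewrite EFin_normr_Rintegral//.
apply: (le_trans (le_abse_integral _ _ _)) => //; first by case/integrableP : intB.
apply: ge0_le_integral_nonmeasurable => // u _ /=.
rewrite lee_fin; have /andP[+ _] := hk u; rewrite ge_min => /orP hku.
apply: (@le_trans _ _ (F u * (`|cos (phase u y) - cos (phase u z)| +
    `|sin (phase u y) - sin (phase u z)|))).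
  rewrite /trig_integrand (_ : _ - _ = phi u * (cos (phase u y) - cos (phase u z)) +
    psi u * (sin (phase u y) - sin (phase u z))); last by ring.
  rewrite [leRHS]mulrDr (le_trans (ler_normD _ _))// !normrM.
  by apply: lerD; apply: ler_wpM2r.
rewrite ler_wpM2l//.
have := cos_lipschitz (phase u y) (phase u z).
have := sin_lipschitz (phase u y) (phase u z).
have := norm_cos_sub_le2 (phase u y) (phase u z).
have := norm_sin_sub_le2 (phase u y) (phase u z).
by case: hku; lra.
Qed.

End trigonometric_integral.

(** * Oscillation of the Fourier transform over one ball *)

Section fourier_oscillation.
Context {R : realType} {n : nat}.
Local Notation mu := (lebesgue_tuple R n).
Implicit Types (f : n.-tuple R -> R[i]) (x y u : n.-tuple R) (r p : R).

Lemma cmod_ge0 (z : R[i]) : 0 <= cmod z.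
Proof. by case: z => a b; exact: sqrtr_ge0. Qed.

Lemma norm_Re_le_cmod (z : R[i]) : `|complex.Re z| <= cmod z.
Proof.
by case: z => a b; rewrite /cmod /= -sqrtr_sqr ler_wsqrtr// lerDl sqr_ge0.
Qed.

Lemma norm_Im_le_cmod (z : R[i]) : `|complex.Im z| <= cmod z.
Proof.
by case: z => a b; rewrite /cmod /= -sqrtr_sqr ler_wsqrtr// lerDr sqr_ge0.
Qed.

Lemma cmod_le_normD (z : R[i]) : cmod z <= `|complex.Re z| + `|complex.Im z|.
Proof.
case: z => a b; rewrite /cmod /= -[leRHS]ger0_norm ?addr_ge0// -sqrtr_sqr.
rewrite ler_wsqrtr// sqrrD !real_normK ?num_real//.
by rewrite addrAC lerDl mulrn_wge0// mulr_ge0.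
Qed.

Lemma measurable_cmod f : L1 f -> measurable_fun setT (fun u => cmod (f u)).
Proof.
move=> [mRe mIm _].
rewrite (_ : (fun u => _) = (fun u => Num.sqrt
  (complex.Re (f u) ^+ 2 + complex.Im (f u) ^+ 2))); last first.
  by apply/funext => u; case: (f u).
apply: (measurableT_comp (f := @Num.sqrt R)).
  by apply: continuous_measurable_fun; exact: sqrt_continuous.
by apply: measurable_funD; exact: measurable_funX.
Qed.

Lemma Re_fourier f y : complex.Re (fourier f y) =
  trig_integral (fun u => complex.Re (f u)) (fun u => - complex.Im (f u)) y.
Proof.
rewrite /fourier /cintegral /= /trig_integral; apply: eq_Rintegral => u _.
by rewrite /trig_integrand /phase /expi; case: (f u) => a b /=; ring.
Qed.

Lemma Im_fourier f y : complex.Im (fourier f y) =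
  trig_integral (fun u => complex.Im (f u)) (fun u => complex.Re (f u)) y.
Proof.
rewrite /fourier /cintegral /= /trig_integral; apply: eq_Rintegral => u _.
by rewrite /trig_integrand /phase /expi; case: (f u) => a b /=; ring.
Qed.

(** Majorant of min(4, 2 |phase difference|) uniform over pairs of points in a ball of radius [r]:
    the factor 8 pi n collects 2 from sine plus cosine, 2 pi from the phase, and n times 2r from the
    inner product. *)
Definition fourier_kernel r u : R :=
  Num.min 4 (8 * pi * n%:R * r * euclid_dist origin u).

Lemma fourier_kernel_ge0 r u : 0 <= r -> 0 <= fourier_kernel r u.
Proof.
by move=> r0; rewrite le_min !mulr_ge0 ?pi_ge0 ?euclid_dist_ge0//= andbT.
Qed.

Lemma measurable_fourier_kernel r :
  measurable_fun [set: n.-tuple R] (fourier_kernel r).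
Proof.
apply: measurable_minr => //; apply: measurable_funM => //.
exact: measurable_euclid_dist.
Qed.

Lemma phase_sub_le_kernel x r u y z : euclid_ball x r y -> euclid_ball x r z ->
  Num.min 4 (2 * `|phase u y - phase u z|) <= fourier_kernel r u <= 4.
Proof.
move=> xy xz; apply/andP; split; last by rewrite ge_min lexx.
rewrite le_min ge_min lexx /= ge_min; apply/orP; right.
rewrite /phase (_ : _ - _ = - (2 * pi * (dotp u y - dotp u z))); last by ring.
rewrite normrN !normrM ger0_norm// [`|pi|]ger0_norm ?pi_ge0//.
rewrite (_ : 8 * pi * n%:R * r * euclid_dist origin u =
   2 * (2 * pi * (n%:R * (euclid_dist origin u * (2 * r))))); last by ring.
apply: ler_wpM2l => //; apply: ler_wpM2l; first by rewrite mulr_ge0// pi_ge0.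
exact: norm_dotp_sub_le xy xz.
Qed.

(** Real and imaginary parts each deviate from their means by at most the kernel integral, whence
    the factor 2. The L_p norm over the ball of this constant bound brings in the measure of the
    ball, at most that of a cube of side 2r. *)
Lemma oscillation_fourier_le f p x r : (0 < n)%N -> 0 < p -> 0 < r -> L1 f ->
  (oscillation p (fourier f) x r <=
   (2 * ((2 * r) ^+ n) `^ p^-1)%:E *
     \int[mu]_u (cmod (f u) * fourier_kernel r u)%:E)%E.
Proof.
move=> n0 p0 r0 Lf; have [mRe mIm intf] := Lf.
have mf := measurable_cmod Lf.
set I := (\int[mu]_u _)%E.
have I0 : (0 <= I)%E.
  apply: integral_ge0 => u _.
  by rewrite lee_fin mulr_ge0 ?cmod_ge0 ?fourier_kernel_ge0 ?ltW.
(* The kernel is at most 4, so the integral is at most four times the L_1 norm; being finite, it can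
   be handled as a real number [D]. *)
have Ioo : (I < +oo)%E.
  apply: (@le_lt_trans _ _ (\int[mu]_u (4%:E * (cmod (f u))%:E))%E).
    apply: ge0_le_integral_nonmeasurable => u _.
      by rewrite lee_fin mulr_ge0 ?cmod_ge0 ?fourier_kernel_ge0 ?ltW.
    by rewrite lee_fin mulrC ler_wpM2r ?cmod_ge0// ge_min lexx.
  have mfE : measurable_fun [set: n.-tuple R] (EFin \o (fun u => cmod (f u))).
    exact/measurable_EFinP.
  rewrite (ge0_integralZl _ measurableT mfE)//; last first.
    by move=> u _; rewrite lee_fin cmod_ge0.
  by rewrite lte_mul_pinfty.
have IE : I = (fine I)%:E by rewrite fineK// ge0_fin_numE.
set D := fine I in IE.
have D0 : 0 <= D by rewrite fine_ge0.
set B := euclid_ball x r.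
have mB : measurable B := measurable_euclid_ball x r.
have B0 : (0 < mu B)%E := lebesgue_tuple_ball_gt0 x n0 r0.
have Ble : (mu B <= ((2 * r) ^+ n)%:E)%E := lebesgue_tuple_ball_le x (ltW r0).
have Boo : (mu B < +oo)%E by rewrite (le_lt_trans Ble)// ltry.
have trigD (phi psi : n.-tuple R -> R) : measurable_fun [set: n.-tuple R] phi ->
    measurable_fun [set: n.-tuple R] psi ->
    (forall u, `|phi u| <= cmod (f u)) -> (forall u, `|psi u| <= cmod (f u)) ->
    forall y, B y -> `|trig_integral phi psi y -
      (fine (mu B))^-1 * \int[mu]_(z in B) trig_integral phi psi z| <= D.
  move=> mphi mpsi phif psif y By; apply: norm_sub_mean_le => //.
    by apply: measurable_funTS; exact: measurable_trig_integral.
  move=> z Bz; rewrite -lee_fin -IE.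
  apply: trig_integral_sub_le => //; first exact: measurable_fourier_kernel.
  by move=> u; exact: phase_sub_le_kernel By Bz.
have gD y : B y -> cmod (fourier f y - average r (fourier f) x) <= 2 * D.
  move=> By; apply: le_trans (cmod_le_normD _) _.
  rewrite mulr2n mulrDl mul1r; apply: lerD.
    have -> : complex.Re (fourier f y - average r (fourier f) x) =
        complex.Re (fourier f y) -
        (fine (mu B))^-1 * \int[mu]_(z in B) complex.Re (fourier f z).
      rewrite /average /cintegral -/B; case: (fourier f y) => a b /=; ring.
    under eq_Rintegral do rewrite Re_fourier.
    rewrite Re_fourier; apply: trigD => //; first exact: measurable_funN.
      by move=> u; exact: norm_Re_le_cmod.
    by move=> u; rewrite normrN; exact: norm_Im_le_cmod.
  have -> : complex.Im (fourier f y - average r (fourier f) x) =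
      complex.Im (fourier f y) -
      (fine (mu B))^-1 * \int[mu]_(z in B) complex.Im (fourier f z).
    rewrite /average /cintegral -/B; case: (fourier f y) => a b /=; ring.
  under eq_Rintegral do rewrite Im_fourier.
  rewrite Im_fourier; apply: trigD => // u.
    exact: norm_Im_le_cmod.
  exact: norm_Re_le_cmod.
have pV0 : 0 <= p^-1 by rewrite invr_ge0 ltW.
rewrite /oscillation -/B IE.
apply: (@le_trans _ _ ((((2 * D) `^ p)%:E * ((2 * r) ^+ n)%:E) `^ p^-1)%E).
  apply: gt0_ler_poweR => //; rewrite ?in_itv/= ?leey ?andbT.
  - by apply: integral_ge0 => y _; rewrite lee_fin powR_ge0.
  - by rewrite mule_ge0// lee_fin ?powR_ge0// exprn_ge0// mulr_ge0// ltW.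
  apply: (@le_trans _ _ (\int[mu]_(y in B) (cst ((2 * D) `^ p)%:E) y)%E).
    apply: ge0_le_integral_nonmeasurable => y By; first by rewrite lee_fin powR_ge0.
    rewrite lee_fin; apply: ge0_ler_powR; rewrite ?nnegrE ?(ltW p0) ?cmod_ge0//.
      by rewrite mulr_ge0.
    exact: gD.
  by rewrite integral_cst// lee_wpmul2l// lee_fin powR_ge0.
rewrite -EFinM poweR_EFin -EFinM lee_fin powRM ?powR_ge0//; last first.
  by rewrite exprn_ge0// mulr_ge0// ltW.
rewrite -powRrM mulfV ?gt_eqF// powRr1 ?mulr_ge0//.
by rewrite mulrAC lexx.
Qed.

End fourier_oscillation.

(** * Weighted oscillation at a fixed dyadic scale *)

Lemma ge0_esum_intZl (R : realType) (c : R) (a : int -> \bar R) : 0 <= c ->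
  (forall k, (0 <= a k)%E) ->
  (\esum_(k in [set: int]) (c%:E * a k) = c%:E * \esum_(k in [set: int]) a k)%E.
Proof.
move=> c0 a0; rewrite !esum_int_nneseries//; last by move=> k; rewrite mule_ge0.
by rewrite nneseriesZl.
Qed.

Section fourier_weighted_oscillation.
Context {R : realType} {n : nat}.
Local Notation mu := (lebesgue_tuple R n).
Implicit Types (f : n.-tuple R -> R[i]) (r p : R).

Lemma weighted_dyadic_mass_ge0 (v : R -> R) f k :
  0 < v (2 ^ k) -> (0 <= weighted_dyadic_mass v f k)%E.
Proof.
move=> v0; apply: mule_ge0; first by rewrite lee_fin invr_ge0 ltW.
by apply: integral_ge0 => u _; rewrite lee_fin cmod_ge0.
Qed.

(** On the annulus |u| <= 2 * 2^k, and r <= 2^(-m), so the linear branch is at most 16 pi n 2^(k-m);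
    the summand 4 in the constant handles the other branch. *)
Lemma fourier_kernel_annulus_le (k m : int) r (u : n.-tuple R) : 0 < r -> 2 ^ m <= 1 / r ->
  dyadic_annulus k u ->
  fourier_kernel r u <= (16 * pi * n%:R + 4) * Num.min 1 (2 ^ (k - m)) :> R.
Proof.
move=> r0 mr [uk _]; have pi0 : 0 <= pi :> R := pi_ge0 R.
have pn0 : 0 <= 16 * pi * n%:R :> R by rewrite !mulr_ge0.
rewrite minr_pMr ?addr_ge0// le_min mulr1; apply/andP; split.
  by rewrite ge_min lerDr pn0.
have km0 : 0 < 2 ^ (k - m) :> R := dyadic_gt0 (k - m).
rewrite ge_min; apply/orP; right.
apply: (@le_trans _ _ (16 * pi * n%:R * 2 ^ (k - m))); last first.
  by rewrite ler_wpM2r ?lerDl// ltW.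
rewrite (_ : 16 * pi * n%:R * _ = 8 * pi * n%:R * (2 * 2 ^ (k - m))); last by ring.
rewrite -[leLHS]mulrA ler_wpM2l ?mulr_ge0//.
have uk' : euclid_dist origin u <= 2 * 2 ^ k.
  by move: uk; rewrite /euclid_ball /= dyadicD expr1z mulrC => /ltW.
have rm : r <= 2 ^ (- m).
  rewrite -[2 ^ _]invr_expz -[r]invrK lef_pV2 ?posrE ?invr_gt0 ?dyadic_gt0//.
  by rewrite -div1r.
rewrite dyadicD mulrA [leRHS]mulrC ler_pM ?euclid_dist_ge0// ltW//.
Qed.

(** The bound [N] on the damped masses is left free: a supremum is inserted for q = +oo and an l^q
    norm for finite q, while [C] and [eta] do not depend on q. *)
Lemma weighted_oscillation_fourier_le (p : R) (v w : R -> R) (n_ge1 : (0 < n)%N)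
    (p_gt0 : 0 < p)
    (v_gt0 : forall r : R, 0 < r -> 0 < v r)
    (w_gt0 : forall r : R, 0 < r -> 0 < w r)
    (v_doubling : doubling v)
    (vw_bounded :
       (ereal_sup [set (r `^ (n%:R / p) * w r * v (1 / r))%:E | r in `]0%R, +oo[]
        < +oo)%E)
    (v_low : exists2 C : R, 0 < C & forall m : int,
       (\esum_(k in [set k : int | (k <= m)%R]) (2 ^ k * v (2 ^ k))%:E
        <= (C * (2 ^ m * v (2 ^ m)))%:E)%E)
    (v_high : exists2 C : R, 0 < C & forall m : int,
       (\esum_(k in [set k : int | (m <= k)%R]) (v (2 ^ k))%:E
        <= (C * v (2 ^ m))%:E)%E) :
  exists2 C : R, 0 < C & exists2 eta : R, 0 < eta < 1 &
  forall f (m : int) (N : \bar R) r, L1 f -> 0 < r -> 2 ^ m <= 1 / r < 2 ^ (m + 1) ->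
    (forall k : int,
      ((eta ^+ `|k - m|)%:E * weighted_dyadic_mass v f k <= N)%E) ->
    (weighted_oscillation p w (fourier f) r <= C%:E * N)%E.
Proof.
have [K K0 [eta eta01 decay]] := dyadic_kernel_decay v_gt0 v_low v_high.
have [Cd Cd0 dbl] := v_doubling.
set S := ereal_sup _ in vw_bounded.
have leS r : 0 < r -> ((r `^ (n%:R / p) * w r * v (1 / r))%:E <= S)%E.
  by move=> r0; apply: ereal_sup_ubound; exists r => //=; rewrite in_itv/= andbT.
have SE : S = (fine S)%:E.
  rewrite fineK// ge0_fin_numE// (le_trans _ (leS 1 ltr01))// lee_fin.
  by rewrite !mulr_ge0 ?powR_ge0 ?ltW// ?v_gt0 ?w_gt0// divr_gt0.
have {}leS r : 0 < r -> r `^ (n%:R / p) * w r * v (1 / r) <= fine S.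
  by move=> /leS; rewrite SE.
move: (fine S) leS => W leW {S SE vw_bounded}.
have W0 : 0 < W.
  apply: lt_le_trans (leW 1 ltr01).
  by rewrite !mulr_gt0 ?powR_gt0 ?v_gt0 ?w_gt0// divr_gt0.
have /andP[eta0 eta1] := eta01.
have eta1' : 0 < 1 - eta by rewrite subr_gt0.
pose E : R := 16 * pi * n%:R + 4.
have E0 : 0 < E by rewrite ltr_wpDl// !mulr_ge0// pi_ge0.
pose C1 := E * K * (2 / (1 - eta)).
have C10 : 0 < C1 by rewrite !mulr_gt0 ?invr_gt0.
(* The factors come from the oscillation over a ball of radius [r] (2 * 2^(n/p)), the sum over
   annuli ([C1]), the passage from v(2^m) to v(1/r) ([Cd]), and the joint bound on the weights
   ([W]). *)
exists (2 * 2 `^ (n%:R / p) * C1 * Cd * W).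
  by rewrite !mulr_gt0 ?powR_gt0 ?invr_gt0.
exists eta => // f m N r Lf r0 /andP[mr rm] HN.
have v0 k : 0 < v (2 ^ k) by apply/v_gt0/dyadic_gt0.
have mf := measurable_cmod Lf.
have N0 : (0 <= N)%E.
  apply: le_trans (HN m); apply: mule_ge0; first by rewrite lee_fin exprn_ge0// ltW.
  exact: weighted_dyadic_mass_ge0.
case: N N0 HN => [N||]// N0 HN; last first.
  by rewrite gt0_muley ?leey// lte_fin !mulr_gt0 ?powR_gt0 ?invr_gt0.
rewrite lee_fin in N0.
have Ik k : (\int[mu]_(u in dyadic_annulus k) (cmod (f u) * fourier_kernel r u)%:E
    <= (E * K * v (2 ^ m) * N)%:E * (eta ^+ `|k - m|)%:E)%E.
  have min0 : 0 <= Num.min 1 (2 ^ (k - m)) :> R.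
    by rewrite le_min ler01 ltW// dyadic_gt0.
  have mfE : measurable_fun (@dyadic_annulus R n k) (EFin \o (fun u => cmod (f u))).
    by apply/measurable_EFinP; exact: measurable_funTS.
  apply: (@le_trans _ _ (\int[mu]_(u in dyadic_annulus k)
      ((E * Num.min 1 (2 ^ (k - m)))%:E * (EFin \o (fun u => cmod (f u))) u))%E).
    apply: ge0_le_integral_nonmeasurable => u uk.
      by rewrite lee_fin mulr_ge0 ?cmod_ge0 ?fourier_kernel_ge0 ?ltW.
    rewrite -EFinM lee_fin mulrC ler_wpM2r ?cmod_ge0//.
    exact: fourier_kernel_annulus_le.
  rewrite (ge0_integralZl _ (@measurable_dyadic_annulus R n k) mfE)//; last 2 first.
    by move=> u _; rewrite lee_fin cmod_ge0.
    by rewrite lee_fin mulr_ge0// ltW.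
  have := HN k; rewrite /weighted_dyadic_mass.
  set J := (\int[_]_(_ in _) _)%E => HJ.
  have J0 : (0 <= J)%E by apply: integral_ge0 => u _; rewrite lee_fin cmod_ge0.
  (* An infinite mass on the annulus would contradict the finite bound [N]. *)
  case: J J0 HJ => [J||]//; last first.
    rewrite gt0_muley ?lte_fin ?invr_gt0// gt0_muley ?lte_fin ?exprn_gt0//.
  rewrite -!EFinM !lee_fin => J0 HJ.
  have := decay k m; set e := eta ^+ _ in HJ *; set b := Num.min _ _ => Hb.
  have e0 : 0 < e by rewrite exprn_gt0.
  have vk0 := v0 k.
  apply: (@le_trans _ _ (E * (b * v (2 ^ k)) * ((v (2 ^ k))^-1 * J))).
    by rewrite le_eqVlt; apply/orP; left; apply/eqP; field; rewrite gt_eqF.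
  apply: (@le_trans _ _ (E * (K * (e * e) * v (2 ^ m)) * ((v (2 ^ k))^-1 * J))).
    by rewrite ler_wpM2r ?mulr_ge0 ?invr_ge0 ?(ltW vk0)// ler_wpM2l// ltW.
  (* One of the two decay factors is absorbed with the mass into [N]; the other remains to make the
     sum over [k] converge. *)
  rewrite (_ : E * _ * _ = E * K * v (2 ^ m) * e * (e * ((v (2 ^ k))^-1 * J))); last by ring.
  rewrite (_ : E * K * v (2 ^ m) * N * e = E * K * v (2 ^ m) * e * N); last by ring.
  by rewrite ler_wpM2l// !mulr_ge0 ?ltW.
have I_le : (\int[mu]_u (cmod (f u) * fourier_kernel r u)%:E <=
    (C1 * v (2 ^ m) * N)%:E)%E.
  have k0 u : (0 <= (cmod (f u) * fourier_kernel r u)%:E)%E.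
    by rewrite lee_fin mulr_ge0 ?cmod_ge0 ?fourier_kernel_ge0 ?ltW.
  (* The annuli miss only the origin, where the kernel vanishes. *)
  have -> : (\int[mu]_u (cmod (f u) * fourier_kernel r u)%:E =
      \int[mu]_(u in \bigcup_k dyadic_annulus k) (cmod (f u) * fourier_kernel r u)%:E)%E.
    rewrite [RHS]integral_mkcond; apply: eq_integral => u _.
    rewrite bigcup_dyadic_annulus patchE; case: ifPn => // /negP.
    rewrite inE /= => /contrapT ->.
    rewrite /fourier_kernel (_ : euclid_dist _ _ = 0) ?mulr0 ?min_r ?mulr0//.
    by rewrite /euclid_dist big1 ?sqrtr0// => i _; rewrite subrr expr0n.
  apply: (le_trans (ge0_integral_int_cover mu
    (@measurable_dyadic_annulus R n) (fun u _ => k0 u))).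
  apply: (@le_trans _ _ (\esum_(k in [set: int])
     ((E * K * v (2 ^ m) * N)%:E * (eta ^+ `|k - m|)%:E))%E).
    by apply: le_esum => k _; exact: Ik.
  have c0 : 0 <= E * K * v (2 ^ m) * N by rewrite !mulr_ge0// ltW.
  rewrite ge0_esum_intZl//; last by move=> k; rewrite lee_fin exprn_ge0 ?ltW.
  apply: (@le_trans _ _ ((E * K * v (2 ^ m) * N)%:E * (2 / (1 - eta))%:E)%E).
    by rewrite lee_wpmul2l// esum_int_geometric.
  by rewrite -EFinM lee_fin le_eqVlt; apply/orP; left; apply/eqP; rewrite /C1; ring.
clearbody C1 E.
have r2 : 0 <= 2 * r by rewrite mulr_ge0 ?ltW.
have powE : ((2 * r) ^+ n) `^ p^-1 = 2 `^ (n%:R / p) * r `^ (n%:R / p).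
  by rewrite -powR_mulrn// -powRrM powRM// ltW.
have wr := w_gt0 _ r0.
rewrite /weighted_oscillation.
apply: (@le_trans _ _ ((w r)%:E * (2 * ((2 * r) ^+ n) `^ p^-1 * (C1 * v (2 ^ m) * N))%:E)%E).
  rewrite lee_wpmul2l ?lee_fin ?(ltW wr)//; apply: ge_ereal_sup => _ [x _ <-].
  apply: (le_trans (oscillation_fourier_le _ n_ge1 p_gt0 r0 Lf)).
  by rewrite [leRHS]EFinM lee_wpmul2l// lee_fin mulr_ge0// powR_ge0.
rewrite -!EFinM lee_fin powE.
(* Since 1/r lies between 2^m and 2 * 2^m, [v] may be moved to the point 1/r, where the joint bound
   on the weights applies. *)
have [_ vle] : v (1 / r) <= Cd * v (2 ^ m) /\ v (2 ^ m) <= Cd * v (1 / r).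
  apply: dbl; first exact: dyadic_gt0.
  by rewrite mr ltW// (lt_le_trans rm)// dyadicD expr1z mulrC.
have P0 : 0 < 2 `^ (n%:R / p) :> R by rewrite powR_gt0.
have Q0 : 0 < r `^ (n%:R / p) by rewrite powR_gt0.
have {}leW := leW r r0.
move: (2 `^ (n%:R / p)) (r `^ (n%:R / p)) P0 Q0 leW => P Q P0 Q0 leW.
apply: (@le_trans _ _ (2 * P * C1 * N * (Q * w r) * (Cd * v (1 / r)))).
  rewrite (_ : w r * _ = 2 * P * C1 * N * (Q * w r) * v (2 ^ m)); last by ring.
  by rewrite ler_wpM2l// !mulr_ge0// ltW.
rewrite (_ : _ * (Cd * _) = 2 * P * C1 * Cd * N * (Q * w r * v (1 / r))); last by ring.
rewrite (_ : _ * W * N = 2 * P * C1 * Cd * N * W); last by ring.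
by rewrite ler_wpM2l// !mulr_ge0// ltW.
Qed.

End fourier_weighted_oscillation.

(** * Double series and dyadic pieces of dr/r *)

Lemma exchange_esum (R : realType) (T1 T2 : choiceType) (a : T1 -> T2 -> \bar R) :
  (forall i j, (0 <= a i j)%E) ->
  (\esum_(i in [set: T1]) \esum_(j in [set: T2]) a i j =
   \esum_(j in [set: T2]) \esum_(i in [set: T1]) a i j)%E.
Proof.
move=> a0; rewrite !esum_esum//.
have swap_bij : set_bij ([set: T1] `*`` (fun=> [set: T2]))
    ([set: T2] `*`` (fun=> [set: T1])) (fun ij => (ij.2, ij.1)).
  split=> [//|[i j] [i' j'] _ _ [-> ->]//|[j i] _].
  by exists (i, j).
by rewrite (reindex_esum _ _ _ _ swap_bij).
Qed.

Lemma le_esum_term (R : realType) (T : choiceType) (a : T -> \bar R) (k : T) :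
  (forall i, (0 <= a i)%E) -> (a k <= \esum_(i in [set: T]) a i)%E.
Proof.
by move=> a0; apply: esum_ge; exists [set k]; rewrite ?fsbig_set1.
Qed.

Lemma poweRK (R : realType) (x : \bar R) (q : R) : 0 < q -> (0 <= x)%E ->
  ((x `^ q) `^ q^-1)%E = x.
Proof. by move=> q0 x0; rewrite -poweRrM mulfV ?gt_eqF// poweRe1. Qed.

Lemma poweRVK (R : realType) (x : \bar R) (q : R) : 0 < q -> (0 <= x)%E ->
  ((x `^ q^-1) `^ q)%E = x.
Proof. by move=> q0 x0; rewrite -poweRrM mulVf ?gt_eqF// poweRe1. Qed.

Lemma esum_geometric_mul_le (R : realType) (eta : R) (k : int) (b : \bar R) :
  0 < eta < 1 -> (0 <= b)%E ->
  (\esum_(m in [set: int]) ((eta ^+ `|k - m|)%:E * b) <= (2 / (1 - eta))%:E * b)%E.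
Proof.
move=> eta01; have /andP[e0 e1] := eta01; case: b => [b||]// b0; last first.
  by rewrite gt0_muley ?leey// lte_fin divr_gt0// subr_gt0.
rewrite lee_fin in b0.
under eq_esum do rewrite muleC distnC.
rewrite ge0_esum_intZl//; last by move=> m; rewrite lee_fin exprn_ge0// ltW.
by rewrite muleC lee_wpmul2r ?esum_int_geometric.
Qed.

Definition inv_dyadic_itv (R : realType) (m : int) : set R :=
  `]2 ^ (- (m + 1)), 2 ^ (- m)]%classic.

Lemma inv_dyadic_itvP (R : realType) (m : int) (r : R) :
  inv_dyadic_itv m r <-> 0 < r /\ 2 ^ m <= 1 / r < 2 ^ (m + 1).
Proof.
rewrite /inv_dyadic_itv /= in_itv /= -!invr_expz div1r; split.
  move=> /andP[mr rm]; have r0 : 0 < r.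
    by apply: le_lt_trans mr; rewrite invr_ge0 ltW// dyadic_gt0.
  split=> //; rewrite -[2 ^ m]invrK -[2 ^ (m + 1)]invrK.
  by rewrite lef_pV2 ?ltf_pV2 ?posrE ?invr_gt0 ?dyadic_gt0// rm mr.
move=> [r0 /andP[mr rm]]; rewrite -[r]invrK.
by rewrite lef_pV2 ?ltf_pV2 ?posrE ?invr_gt0 ?dyadic_gt0// rm mr.
Qed.

Lemma bigcup_inv_dyadic_itv (R : realType) :
  \bigcup_m (@inv_dyadic_itv R m) = `]0%R, +oo[%classic.
Proof.
apply/seteqP; split => r /=; rewrite in_itv /= andbT.
  by move=> [m _ /inv_dyadic_itvP[]].
move=> r0; have [m mr] : exists m : int, 2 ^ m <= 1 / r < 2 ^ (m + 1).
  by apply: dyadic_scale; rewrite divr_gt0.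
by exists m => //; apply/inv_dyadic_itvP.
Qed.

(** The interval has length 2^(-(m+1)) and 1/r is below 2^(m+1) on it, so the dr/r measure of the
    interval is at most 1. *)
Lemma integral_inv_dyadic_itv_le (R : realType) (m : int) (g : R -> \bar R)
    (M : \bar R) :
  (forall r, inv_dyadic_itv m r -> (0 <= g r <= M)%E) ->
  (\int[lebesgue_measure]_(r in inv_dyadic_itv m) (g r * r^-1%:E) <= M)%E.
Proof.
move=> gM; have e0 := dyadic_gt0 (R := R) (m + 1).
apply: (@le_trans _ _ (\int[lebesgue_measure]_(r in inv_dyadic_itv m)
    (cst (M * (2 ^ (m + 1))%:E)) r)%E).
  apply: ge0_le_integral_nonmeasurable => r rm.
    have /inv_dyadic_itvP[r0 _] := rm; have /andP[g0 _] := gM _ rm.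
    by rewrite mule_ge0// lee_fin invr_ge0 ltW.
  have /inv_dyadic_itvP[r0 /andP[_ /ltW rm1]] := rm.
  have /andP[g0 gM'] := gM _ rm.
  rewrite div1r in rm1.
  by apply: lee_pmul => //; rewrite lee_fin// invr_ge0 ltW.
rewrite integral_cst; last exact: measurable_itv.
have E : 2 ^ (- m) = 2 * 2 ^ (- (m + 1)) :> R.
  by rewrite opprD dyadicD exprN1 mulrCA mulfV ?mulr1.
have muI : lebesgue_measure (@inv_dyadic_itv R m) = (2 ^ (- (m + 1)))%:E.
  have lt : 2 ^ (- (m + 1)) < 2 ^ (- m) :> R.
    by rewrite E mulr2n mulrDl mul1r ltrDl dyadic_gt0.
  by rewrite lebesgue_measure_itv /= lte_fin lt -EFinD E mulr2n mulrDl mul1r addrK.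
rewrite [X in (_ * X)%E](_ : _ = (2 ^ (- (m + 1)))%:E); last exact: muI.
by rewrite -muleA -EFinM -dyadicD subrr expr0z mule1.
Qed.

(** * The endpoint q = +oo, and summation over scales for finite q *)

Theorem theorem6p1 (R : realType) (n : nat) (n_ge1 : (1 <= n)%N)
    (p : R) (p_ge1 : 1 <= p) (q : \bar R) (q_gt0 : (0 < q)%E)
    (v w : R -> R)
    (v_gt0 : forall r : R, 0 < r -> 0 < v r)
    (w_gt0 : forall r : R, 0 < r -> 0 < w r)
    (v_doubling : doubling v) (w_doubling : doubling w)
    (vw_bounded :
       (ereal_sup [set (r `^ (n%:R / p) * w r * v (1 / r))%:E | r in `]0%R, +oo[]
        < +oo)%E)
    (v_low : exists2 C : R, 0 < C & forall m : int,
       (\esum_(k in [set k : int | (k <= m)%R]) (2 ^ k * v (2 ^ k))%:E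
        <= (C * (2 ^ m * v (2 ^ m)))%:E)%E)
    (v_high : exists2 C : R, 0 < C & forall m : int,
       (\esum_(k in [set k : int | (m <= k)%R]) (v (2 ^ k))%:E
        <= (C * v (2 ^ m))%:E)%E) :
  exists2 C : R, 0 < C & forall f : n.-tuple R -> R[i], L1 f ->
    (campanato p q w (fourier f) <= C%:E * dyadic_norm q v f)%E.
Proof.
have p_gt0 : 0 < p by apply: lt_le_trans p_ge1.
have [C C0 [eta /andP[eta0 eta1] osc]] := weighted_oscillation_fourier_le
  n_ge1 p_gt0 v_gt0 w_gt0 v_doubling vw_bounded v_low v_high.
have e0 k m : 0 < eta ^+ `|k - m| :> R by rewrite exprn_gt0.
have a0 (f : n.-tuple R -> R[i]) k : (0 <= weighted_dyadic_mass v f k)%E.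
  exact/weighted_dyadic_mass_ge0/v_gt0/dyadic_gt0.
case: q q_gt0 => [q||]// q0; last first.
  exists C => // f Lf; apply: ge_ereal_sup => _ [r /= + <-].
  rewrite in_itv /= andbT => r0.
  have [m mr] : exists m : int, 2 ^ m <= 1 / r < 2 ^ (m + 1).
    by apply: dyadic_scale; rewrite divr_gt0.
  (* Here [N] is the dyadic norm itself: the damping factor is at most 1, so each damped mass is
     below the supremum. *)
  apply: (osc f m) => // k.
  apply: (@le_trans _ _ (weighted_dyadic_mass v f k)).
    by rewrite gee_pMl// lee_fin exprn_ile1// ltW.
  by apply: ereal_sup_ubound; exists k.
rewrite lte_fin in q0.
have etaX j : (eta ^+ j) `^ q = (eta `^ q) ^+ j.
  rewrite -(powR_mulrn j (ltW eta0)) -(powR_mulrn j (powR_ge0 _ _)).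
  by rewrite -[LHS]powRrM -[RHS]powRrM mulrC.
have qe01 : 0 < eta `^ q < 1.
  rewrite powR_gt0//= (_ : 1 = 1 `^ q); last by rewrite powR1.
  by rewrite gt0_ltr_powR ?nnegrE ?ltW.
(* Bound for the two-sided geometric series of ratio eta^q, which arises when the q-th powers of the
   damped masses are summed over the scales [m]. *)
pose H := 2 / (1 - eta `^ q).
have H0 : 0 < H by case/andP: qe01 => _ ?; rewrite divr_gt0// subr_gt0.
exists (C * H `^ q^-1); first by rewrite mulr_gt0// powR_gt0.
move=> f Lf; rewrite /campanato /dyadic_norm.
set a := weighted_dyadic_mass v f.
pose x m k : \bar R := ((eta ^+ `|k - m|)%:E * a k)%E.
have x0 m k : (0 <= x m k)%E by rewrite mule_ge0 ?lee_fin ?(ltW (e0 _ _))// a0.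
pose T m : \bar R := (\esum_(k in [set: int]) x m k `^ q)%E.
have T0 m : (0 <= T m)%E by apply: esum_ge0 => k _; exact: poweR_ge0.
(* Here [N] is the l^q norm T(m)^(1/q), which dominates each of its terms for every q > 0. *)
have oscT m r : inv_dyadic_itv m r ->
    (weighted_oscillation p w (fourier f) r <= C%:E * T m `^ q^-1)%E.
  move=> /inv_dyadic_itvP[r0 mr]; apply: (osc f m) => // k.
  rewrite -/a -/(x m k) -[leLHS](poweRK q0)//.
  apply: gt0_ler_poweR; rewrite ?in_itv/= ?poweR_ge0 ?leey ?T0 ?invr_ge0 ?(ltW q0)//.
  by apply: (le_esum_term (a := fun k => x m k `^ q)%E) => i; exact: poweR_ge0.
have osc0 r : 0 < r -> (0 <= weighted_oscillation p w (fourier f) r)%E.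
  move=> r0; apply: mule_ge0; first by rewrite lee_fin ltW// w_gt0.
  apply: (@le_trans _ _ (oscillation p (fourier f) origin r)).
    exact: poweR_ge0.
  by apply: ereal_sup_ubound; exists origin.
have Cq0 : 0 <= C `^ q by exact: powR_ge0.
have main : (\int[lebesgue_measure]_(r in `]0%R, +oo[)
      (weighted_oscillation p w (fourier f) r `^ q * r^-1%:E) <=
    (C `^ q * H)%:E * \esum_(k in [set: int]) a k `^ q)%E.
  rewrite -bigcup_inv_dyadic_itv.
  apply: (@le_trans _ _ (\esum_(m in [set: int]) ((C `^ q)%:E * T m))%E).
    apply: (le_trans (ge0_integral_int_cover _ _ _)).
    - by move=> m; exact: measurable_itv.
    - move=> r [m _ /inv_dyadic_itvP[r0 _]].
      by rewrite mule_ge0 ?poweR_ge0// lee_fin invr_ge0 ltW.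
    apply: le_esum => m _; apply: integral_inv_dyadic_itv_le => r rm.
    rewrite poweR_ge0 /=; have /inv_dyadic_itvP[r0 _] := rm.
    (* The bound C^q T(m) is rewritten as the q-th power of C T(m)^(1/q), so that monotonicity of
       the power reduces it to [oscT]. *)
    rewrite -[X in (_ * X)%E](poweRVK q0)// -poweR_EFin -poweRM//; last 2 first.
      by rewrite lee_fin ltW.
      exact: poweR_ge0.
    have CT0 : (0 <= C%:E * T m `^ q^-1)%E.
      by rewrite mule_ge0 ?poweR_ge0// lee_fin ltW.
    apply: gt0_ler_poweR; rewrite ?in_itv/= ?leey ?andbT ?(ltW q0)// ?osc0//.
    exact: oscT.
  rewrite ge0_esum_intZl// EFinM -muleA lee_wpmul2l//.
  (* Summing over [m] first, for fixed [k], leaves a geometric series of ratio eta^q times the q-th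
     power of the k-th mass. *)
  rewrite /T exchange_esum; last by move=> *; exact: poweR_ge0.
  rewrite -ge0_esum_intZl ?(ltW H0)//; last by move=> k; exact: poweR_ge0.
  apply: le_esum => k _.
  apply: le_trans (esum_geometric_mul_le k qe01 (poweR_ge0 _ _)).
  apply: le_esum => m _; rewrite /x poweRM ?a0 ?lee_fin ?(ltW (e0 _ _))//.
  by rewrite poweR_EFin etaX.
apply: (@le_trans _ _ (((C `^ q * H)%:E * \esum_(k in [set: int]) a k `^ q) `^ q^-1)%E).
  have S0 : (0 <= \esum_(k in [set: int]) a k `^ q)%E.
    by apply: esum_ge0 => k _; exact: poweR_ge0.
  apply: gt0_ler_poweR; rewrite ?in_itv/= ?leey ?andbT ?invr_ge0 ?(ltW q0)//.
  - apply: integral_ge0 => r /=; rewrite in_itv /= andbT => r0.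
    by rewrite mule_ge0 ?poweR_ge0// lee_fin invr_ge0 ltW.
  - by rewrite mule_ge0// lee_fin mulr_ge0// ltW.
rewrite poweRM; last 2 first.
- by rewrite lee_fin mulr_ge0// ltW.
- by apply: esum_ge0 => k _; exact: poweR_ge0.
rewrite poweR_EFin powRM ?(ltW H0)// -powRrM mulfV ?gt_eqF// powRr1 ?(ltW C0)//.
Qed.
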